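(* Let $X$ be a real normed space and let $f\colon X \to \mathbb{R}$ be a continuously Fréchet differentiable function. Then the following properties are equivalent: (a) The function $f$ is quasiconvex. (b) For any $x, y\in X$, we have the implication $$f(x) \leq f(y) \ \Longrightarrow\ \langle \nabla f(y), y-x\rangle \geq 0.$$ (c) For any $x, y\in X$, we have the implication $$\langle \nabla f(x), y-x\rangle> 0\ \Longrightarrow\ \langle \nabla f(y), y-x\rangle\geq 0.$$
   Context: $X^*$ denotes the topological dual of the real normed space $X$, and $\langle x^*, x\rangle = x^*(x)$ for $x^*\in X^*$, $x\in X$. For a Fréchet differentiable $f\colon X\to\mathbb{R}$, $\nabla f(x)\in X^*$ denotes the Fréchet derivative of $f$ at $x$; continuously Fréchet differentiable means that $x\mapsto\nabla f(x)$ is continuous from $X$ to $X^*$ with its norm topology. A function $f\colon X\to\mathbb{R}$ is quasiconvex if for all $x,y\in X$ and all $\lambda\in(0,1)$, $$f(\lambda x+(1-\lambda)y)\le \max\{f(x),f(y)\}.$$ *)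

(* Defs.v *)
From mathcomp Require Import all_boot all_order all_algebra.
From mathcomp Require Import all_classical all_reals all_analysis.

Set Implicit Arguments.
Unset Strict Implicit.
Unset Printing Implicit Defensive.

Import Order.TTheory GRing.Theory Num.Theory.
Import numFieldNormedType.Exports.

Local Open Scope classical_set_scope.
Local Open Scope ring_scope.

Definition quasiconvex (R : realType) (X : lmodType R) (f : X -> R) : Prop :=
  forall (x y : X) (l : R), 0 < l -> l < 1 ->
    f (l *: x + (1 - l) *: y) <= Num.max (f x) (f y).

(* The operator norm of the dual of X, as an extended real: it is +oo on
   unbounded maps and finite on continuous linear functionals. *)
Definition dual_norm (R : realType) (X : normedModType R) (phi : X -> R)
    : \bar R :=
  ereal_sup [set (`|phi h|)%:E | h in [set h : X | `|h| <= 1]].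

(* The second clause is continuity of x |-> 'd f x for the norm topology of
   the dual: 'd f y tends to 'd f x in [dual_norm] as y tends to x. *)
Definition continuously_differentiable (R : realType) (X : normedModType R)
    (f : X -> R) : Prop :=
  (forall x : X, differentiable f x) /\
  (forall x : X,
     dual_norm (fun h : X => 'd f y h - 'd f x h) @[y --> x] --> (0 : \bar R)%E).

(* Main.v *)
(* (a) => (b) is the sign of the one-sided difference quotients of f at y towards
   x, and (b) => (c) compares f x with f y. For (c) => (a), if f exceeded
   max (f x) (f y) somewhere inside the segment from y to x, the mean value
   theorem would give on that segment a point of positive slope followed by one
   of negative slope, which (c) forbids. *)

Require Import Defs.
From mathcomp Require Import all_boot all_order all_algebra.
From mathcomp Require Import all_classical all_reals all_analysis.
Set Implicit Arguments.
Unset Strict Implicit.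
Unset Printing Implicit Defensive.

Import Order.TTheory GRing.Theory Num.Theory.
Import numFieldNormedType.Exports.

Local Open Scope classical_set_scope.
Local Open Scope ring_scope.

(** Along the line, the difference quotients at [t] are exactly those of [f] at [y + t *: d] in
    direction [d]. *)
Lemma is_derive_line (R : realType) (X : normedModType R) (f : X -> R)
    (y d : X) (t : R) :
  differentiable f (y + t *: d) ->
  is_derive t 1 (fun s : R => f (y + s *: d)) ('d f (y + t *: d) d).
Proof.
move=> df.
have E : (fun h : R => h^-1 *: (((fun s : R => f (y + s *: d)) \o shift t)
             (h *: (1 : R)) - f (y + t *: d))) =
         (fun h : R => h^-1 *: ((f \o shift (y + t *: d)) (h *: d)
             - f (y + t *: d))).
  by apply/funext => h /=; rewrite [h *: 1]mulr1 scalerDl addrCA.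
by split; rewrite /derivable /derive E;
  [exact: diff_derivable | exact: deriveE].
Qed.

Lemma MVT_line (R : realType) (X : normedModType R) (f : X -> R)
    (y d : X) (a b : R) :
  (forall z, differentiable f z) -> a < b ->
  exists2 c : R, a < c < b &
    f (y + b *: d) - f (y + a *: d) = 'd f (y + c *: d) d * (b - a).
Proof.
move=> df ab.
have dl (t : R) : is_derive t 1 (fun s : R => f (y + s *: d)) ('d f (y + t *: d) d).
  exact: is_derive_line.
have cl : {within `[a, b], continuous (fun s : R => f (y + s *: d))}.
  apply: continuous_subspaceT => t.
  by apply: differentiable_continuous; apply/derivable1_diffP; case: (dl t).
have [c] := MVT ab (fun t _ => dl t) cl.
by rewrite in_itv /= => acb fE; exists c.
Qed.

Lemma quasiconvex_diff_ge0 (R : realType) (X : normedModType R) (f : X -> R)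
    (x y : X) :
  quasiconvex f -> differentiable f y -> f x <= f y -> 0 <= 'd f y (y - x).
Proof.
move=> qf df fxy.
rewrite -opprB linearN oppr_ge0 -deriveE//.
(* The limit is taken from the right: quasiconvexity with weight [h] on [x] bounds
   [f (y + h *: (x - y))] by [f y] for [0 < h < 1]. *)
apply: (@cvgr_to_le _ (0 : R)^'+ _ _
    (fun h : R => h^-1 *: ((f \o shift y) (h *: (x - y)) - f y))).
  by apply: cvg_dnbhs_at_right; exact: (@diff_derivable _ _ _ f y (x - y) df).
near=> h.
have h0 : 0 < h by near: h; exact: nbhs_right_gt.
have h1 : h < 1 by near: h; exact: nbhs_right_lt.
rewrite /= -[_ *: _]/(_ * _) pmulr_rle0 ?invr_gt0// subr_le0.
have := qf x y h h0 h1; rewrite (max_idPr fxy).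
by rewrite scalerBr scalerBl scale1r addrCA addrC -addrA [- _ + _]addrC.
Unshelve. all: by end_near. Qed.

Lemma quasiconvex_of_diff (R : realType) (X : normedModType R) (f : X -> R) :
  (forall z, differentiable f z) ->
  (forall x y : X, 0 < 'd f x (y - x) -> 0 <= 'd f y (y - x)) ->
  quasiconvex f.
Proof.
move=> df fc x y l l0 l1; rewrite leNgt gt_max; apply/negP => /andP[fx fy].
have lE : l *: x + (1 - l) *: y = y + l *: (x - y).
  by rewrite scalerBl scale1r scalerBr addrCA.
move: fx fy; rewrite {}lE; set d := x - y => fx fy.
(* From parameter 0 (the point [y]) to [l] the value rises strictly, and from [l] to 1 (the point
   [x]) it falls strictly; hence slopes of opposite sign at some [s < l < t]. *)
have [s /andP[_ sl] fs] := MVT_line y d df l0.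
have [t /andP[lt _] ft] := MVT_line y d df l1.
have st : 0 < t - s by rewrite subr_gt0 (lt_trans sl).
have ds : 0 < 'd f (y + s *: d) d.
  by rewrite -(pmulr_lgt0 _ l0) -[X in _ * X]subr0 -fs scale0r addr0 subr_gt0.
have dt : 'd f (y + t *: d) d < 0.
  have l1' : 0 < 1 - l by rewrite subr_gt0.
  by rewrite -(pmulr_llt0 _ l1') -ft scale1r subrKC subr_lt0.
(* The two points differ by a positive multiple of [d], so the signs of the slopes along [d] carry
   over. *)
have := fc (y + s *: d) (y + t *: d).
have -> : y + t *: d - (y + s *: d) = (t - s) *: d.
  by rewrite opprD addrACA subrr add0r scalerBl.
rewrite !linearZ /= -![_ *: _]/(_ * _) => /(_ (mulr_gt0 st ds)).
by rewrite pmulr_rge0// leNgt dt.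
Qed.

Theorem theorem2p1 (R : realType) (X : normedModType R) (f : X -> R)
    (hf : continuously_differentiable f) :
  [<-> quasiconvex f;
       forall x y : X, f x <= f y -> 0 <= 'd f y (y - x);
       forall x y : X, 0 < 'd f x (y - x) -> 0 <= 'd f y (y - x)].
Proof.
have [df _] := hf.
tfae.
- by move=> qf x y; exact: quasiconvex_diff_ge0.
(* If [f y < f x], the implication with [x] and [y] exchanged gives [0 <= 'd f x (x - y)],
   contradicting [dxy]. *)
- move=> fb x y dxy; have [/fb//|/ltW/fb] := leP (f x) (f y).
  by rewrite -opprB linearN oppr_ge0 leNgt dxy.
- exact: quasiconvex_of_diff.
Qed.
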